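(* Suppose that tasks $\{k,\dots,n\}$ form an active period on the optimal sample path of $Q(1,N)$. If the system is OFF before task $k$ arrives in on-line control, then the wake-up time returned by the on-line control mechanism (described in the context) is optimal, i.e. it equals the optimal starting time of that active period in the off-line problem $Q(1,N)$.
   Context: System. Tasks $i=1,\dots,N$, indexed in order of arrival ($a_1\le\dots\le a_N$), have arrival time $a_i$, deadline $d_i=a_i+d$ and $B$ operations each ($d,B>0$ constants). The system is either OFF (rate $0$, no cost) or ON (rate $R$). Each task takes $\beta=B/R$ time. While ON, the cost per unit time is $C_B$ when a task is being served (busy) and $C_I$ when idling, $C_I\le C_B$. Each OFF-to-ON transition costs $C_W$. An active period (AP) is a time interval $[t_1,t_2]$, $t_1<t_2$, such that the system is woken up at $t_1$, put to sleep at $t_2$ and kept ON in between. Tasks are served in order. Off-line problem $Q(1,N)$ (all arrival times known): choose a number $\alpha$ of APs and instants $t_{i,1}<t_{i,2}$, $i=1,\dots,\alpha$, with $t_{i,2}<t_{j,1}$ for $i<j$, to minimize $$J=\alpha C_W+\sum_{i=1}^{\alpha}\left[C_I(t_{i,2}-t_{i,1}-\tau_{i,B})+C_B\tau_{i,B}\right]$$ subject to $\int_{\max(a_j,x_{j-1})}^{x_j}r(t)\,dt=B$ and $x_j\le d_j$ for $j=1,\dots,N$, with $x_0=0$ and $r(t)=R\sum_{i=1}^{\alpha}[u(t-t_{i,1})-u(t-t_{i,2})]$. Here $x_j$ is the departure time of task $j$, $u$ is the unit step function, and $\tau_{i,B}$ is the total length of time in the $i$-th AP during which tasks are actually being served.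 An optimal sample path is the system trajectory under an optimal solution. The optimal starting time of an AP means the cost-minimizing feasible start; the convention is that APs are started as late as possible, so in case of ties it is the latest one. Standing assumption: within any time interval of $d$ seconds the number of task arrivals does not exceed $\lfloor d/\beta\rfloor$; moreover $\lfloor d/\beta\rfloor>1$. On-line control mechanism (future arrivals unknown). With the system OFF and no backlog, when task $k$ arrives the scheduled wake-up time is set to $a_k+d-\beta=d_k-\beta$. Whenever another task arrives before the currently scheduled wake-up time, the wake-up time is recomputed from the tasks known so far: if $k+1,\dots,k+q$ have arrived since task $k$, it becomes $d_k-\beta-\max\{0,\max_{k+1\le j\le k+q}\delta_j\}$, where $\delta_j=\beta(j-k)-(a_j-a_k)$. If no task arrives before the scheduled wake-up time, the system is woken up at the scheduled time, which is the returned wake-up time. *)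

(* Defs.v *)
From HB Require Import structures.
From mathcomp Require Import all_boot all_order all_algebra.
From mathcomp Require Import all_classical all_reals all_analysis.

Set Implicit Arguments.
Unset Strict Implicit.
Unset Printing Implicit Defensive.

Import Order.TTheory GRing.Theory Num.Theory.
Import numFieldNormedType.Exports.

Local Open Scope classical_set_scope.
Local Open Scope ring_scope.

(* Tasks are numbered 1, ..., ntask; values of [arrival] at other indices are
   irrelevant. *)
Record model (R : realType) := Model {
  ntask : nat;
  arrival : nat -> R;
  delay : R;      (* d: every task is due d after its arrival *)
  ops : R;        (* B *)
  speed : R;      (* R: the rate of the system when ON *)
  cost_wake : R;  (* C_W *)
  cost_idle : R;  (* C_I *)
  cost_busy : R   (* C_B *)
}.

Definition is_task (R : realType) (M : model R) (j : nat) : Prop :=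
  (1 <= j <= ntask M)%N.

Definition deadline (R : realType) (M : model R) (j : nat) : R :=
  arrival M j + delay M.

Definition beta (R : realType) (M : model R) : R := ops M / speed M.

(* The windows are half-open; since there are finitely many tasks, windows
   open at both ends would give the same condition, and closed windows a
   stronger one. *)
Definition bounded_density (R : realType) (M : model R) : Prop :=
  forall t : R,
    #|[set j : 'I_(ntask M) | t <= arrival M j.+1 < t + delay M]%SET|%:Z
      <= Num.floor (delay M / beta M).

(* A trajectory: the instants t_{i,1} ([wake]) and t_{i,2} ([sleep]) of its
   active periods, and the departure times x_j of the tasks ([departure]). *)
Record trajectory (R : realType) := Trajectory {
  nperiod : nat;
  wake : 'I_nperiod -> R;
  sleep : 'I_nperiod -> R;
  departure : nat -> R
}.
Arguments wake {R} _ _.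
Arguments sleep {R} _ _.

Definition unit_step (R : realType) (t : R) : R := if 0 <= t then 1 else 0.

Definition rate (R : realType) (M : model R) (S : trajectory R) (t : R) : R :=
  speed M * \sum_(i < nperiod S)
    (unit_step (t - wake S i) - unit_step (t - sleep S i)).

Definition ordered_periods (R : realType) (S : trajectory R) : Prop :=
  (forall i : 'I_(nperiod S), wake S i < sleep S i) /\
  (forall i j : 'I_(nperiod S), (i < j)%N -> sleep S i < wake S j).

(* The interval between the instant at which task j is at the head of the
   queue and its departure; its intersection with the ON times is the set of
   times at which j is being served. *)
Definition service_window (R : realType) (M : model R) (S : trajectory R)
    (j : nat) : set R :=
  `[Num.max (arrival M j) (departure S j.-1), departure S j].

Definition all_served (R : realType) (M : model R) (S : trajectory R) : Prop :=
  departure S 0 = 0 /\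
  forall j : nat, is_task M j ->
    \int[lebesgue_measure]_(t in service_window M S j) rate M S t = ops M.

Definition active_period (R : realType) (S : trajectory R)
    (i : 'I_(nperiod S)) : set R := `[wake S i, sleep S i].

(* tau_{i,B} *)
Definition busy_time (R : realType) (M : model R) (S : trajectory R)
    (i : 'I_(nperiod S)) : R :=
  fine (lebesgue_measure (active_period i `&`
          \bigcup_(j in [set j | is_task M j]) service_window M S j)).

Definition cost (R : realType) (M : model R) (S : trajectory R) : R :=
  (nperiod S)%:R * cost_wake M +
  \sum_(i < nperiod S)
    (cost_idle M * (sleep S i - wake S i - busy_time M i)
     + cost_busy M * busy_time M i).

Definition feasible (R : realType) (M : model R) (S : trajectory R) : Prop :=
  [/\ ordered_periods S,
      all_served M S &
      forall j : nat, is_task M j -> departure S j <= deadline M j].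

Definition optimal (R : realType) (M : model R) (S : trajectory R) : Prop :=
  feasible M S /\ forall S' : trajectory R, feasible M S' -> cost M S <= cost M S'.

Definition time_served_in (R : realType) (M : model R) (S : trajectory R)
    (i : 'I_(nperiod S)) (j : nat) : R :=
  fine (lebesgue_measure (active_period i `&` service_window M S j)).

(* Tasks k, ..., n are served entirely within period i, and no other task
   receives any service there. In particular, since putting the system to
   sleep in the middle of a service is feasible, a period that starts or ends
   in the middle of a service is not formed by any range of tasks. *)
Definition form_period (R : realType) (M : model R) (S : trajectory R)
    (i : 'I_(nperiod S)) (k n : nat) : Prop :=
  [/\ (1 <= k)%N, (k <= n)%N, (n <= ntask M)%N &
      forall j : nat, is_task M j ->
        time_served_in M i j = if (k <= j <= n)%N then beta M else 0].

(* The latest of the starting times that the period {k, ..., n} has on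
   optimal trajectories on which these tasks form a period: by convention,
   ties between cost-minimizing starts are resolved in favour of the latest. *)
Definition optimal_start (R : realType) (M : model R) (k n : nat) (t : R) : Prop :=
  (exists (S : trajectory R) (i : 'I_(nperiod S)),
     [/\ optimal M S, form_period M i k n & wake S i = t]) /\
  (forall (S : trajectory R) (i : 'I_(nperiod S)),
     optimal M S -> form_period M i k n -> wake S i <= t).

Definition deadline_shift (R : realType) (M : model R) (k j : nat) : R :=
  beta M * (j - k)%:R - (arrival M j - arrival M k).

(* The wake-up time scheduled once k+1, ..., k+q have arrived since task k.
   The initial value 0 of the iterated maximum is the outer max{0, .}. *)
Definition scheduled_wakeup (R : realType) (M : model R) (k q : nat) : R :=
  deadline M k - beta M -
  \big[Num.max/0]_(k.+1 <= j < (k + q).+1) deadline_shift M k j.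

(* [find] yields the least q < ntask - k such that task k+q+1 does not arrive
   before the wake-up time scheduled once k+1, ..., k+q are known, and
   ntask - k (no further arrival) if there is none. *)
Definition online_wakeup (R : realType) (M : model R) (k : nat) : R :=
  scheduled_wakeup M k
    (find (fun q => ~~ (arrival M (k + q).+1 < scheduled_wakeup M k q))
          (iota 0 (ntask M - k))).

(* The system is OFF just before the arrival of task k, and no task that
   arrived earlier is still waiting. *)
Definition off_before (R : realType) (M : model R) (S : trajectory R)
    (k : nat) : Prop :=
  (\forall t \near (arrival M k)^'-, rate M S t = 0) /\
  (forall j : nat, is_task M j -> (j < k)%N -> departure S j <= arrival M k).

Definition first_wakeup_from (R : realType) (S : trajectory R) (t0 w : R) : Prop :=
  [/\ t0 <= w,
      exists i : 'I_(nperiod S), wake S i = w &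
      forall i : 'I_(nperiod S), t0 <= wake S i -> w <= wake S i].

(* A trajectory under on-line control. Only wake-ups are prescribed; the
   decisions to put the system to sleep are arbitrary. *)
Definition online_trajectory (R : realType) (M : model R) (S : trajectory R) : Prop :=
  [/\ ordered_periods S,
      all_served M S &
      forall k : nat, is_task M k -> off_before M S k ->
        first_wakeup_from S (arrival M k) (online_wakeup M k)].

(* Main.v *)
(* Write w for the on-line wake-up time and c = (n - k + 1) beta.

   If period i forms {k, ..., n} and starts at t, every task j >= k is served
   after t, also when j > n, so t + (j - k + 1) beta <= d_j.  Minimizing over all
   known tasks j >= k gives t <= w.  The density assumption makes the tasks that
   arrive after w harmless: w + (j - k + 1) beta <= d_j holds for them too.

   Conversely, restart period i of an optimal trajectory at w, serve k, ..., n
   without avoidable delay, and go to sleep when n departs, at time y.  No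
   deadline is missed and the period does not get longer.  Hence the cost does
   not increase, since the total busy time of any trajectory is N beta.  This is
   legitimate as long as y precedes the next wake-up u.  Otherwise y = w + c;
   restarting at u - c instead makes the period end exactly at u, and merging it
   with the next one saves C_W, contradicting optimality. *)

Require Import Defs.
From HB Require Import structures.
From mathcomp Require Import all_boot all_order all_algebra.
From mathcomp Require Import all_classical all_reals all_analysis.
From mathcomp Require Import measurable_realfun.
From mathcomp Require Import zify ring lra.

Import Order.TTheory GRing.Theory Num.Theory.
Import numFieldNormedType.Exports.

Local Open Scope ring_scope.

Set Implicit Arguments.
Unset Strict Implicit.
Unset Printing Implicit Defensive.

(** * Service received, as lengths of intersections of intervals *)

Definition overlap (R : realType) (u v a b : R) : R :=
  Num.max 0 (Num.min v b - Num.max u a).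

Lemma overlap_ge0 (R : realType) (u v a b : R) : 0 <= overlap u v a b.
Proof. by rewrite le_max lexx. Qed.

Lemma overlap_eq0 (R : realType) (u v a b : R) :
  (overlap u v a b == 0) = (Num.min v b <= Num.max u a).
Proof. by rewrite eq_le overlap_ge0 andbT ge_max lexx subr_le0. Qed.

Lemma measure_overlap (R : realType) (u v a b : R) :
  lebesgue_measure (`[u, v] `&` `[a, b])%classic = (overlap u v a b)%:E.
Proof.
have -> : (`[u, v] `&` `[a, b] = `[Num.max u a, Num.min v b])%classic.
  apply/seteqP; split=> x /=; rewrite !in_itv/= ge_max le_min.
    by move=> [/andP[-> ->] /andP[-> ->]].
  by move=> /andP[/andP[-> ->] /andP[-> ->]].
rewrite lebesgue_measure_itv/= lte_fin /overlap.
move: (Num.max u a) (Num.min v b) => p q; case: (ltP p q) => pq.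
  by rewrite max_r ?subr_ge0 ?ltW.
by rewrite max_l// subr_le0.
Qed.

Lemma unit_stepB (R : realType) (u v t : R) : u <= v ->
  unit_step (t - u) - unit_step (t - v) = \1_(`[u, v[%classic) t.
Proof.
move=> uv; rewrite /unit_step indicE mem_setE in_itv/= !subr_ge0.
case: (leP u t) => ut; case: (leP v t) => vt //=; rewrite ?subrr ?subr0//.
by move: (lt_le_trans ut uv); rewrite ltNge vt.
Qed.

Lemma integral_rate (R : realType) (M : model R) (S : trajectory R) (a b : R) :
  0 <= speed M -> (forall i, wake S i <= sleep S i) ->
  \int[lebesgue_measure]_(t in `[a, b]) rate M S t =
  speed M * \sum_(i < nperiod S) overlap (wake S i) (sleep S i) a b.
Proof.
move=> speed0 uv; rewrite /Rintegral.
under eq_integral => t _.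
  rewrite /rate EFinM -sumEFin.
  under eq_bigr do rewrite unit_stepB//.
  over.
rewrite ge0_integralZl//; last 2 first.
- apply: emeasurable_sum => i; apply/measurable_EFinP; exact: measurable_indic.
- by move=> t _; apply: sume_ge0 => i _; rewrite lee_fin.
rewrite ge0_integral_sum//; last first.
  by move=> i; apply/measurable_EFinP; exact: measurable_indic.
have -> : (\sum_(i < nperiod S) \int[lebesgue_measure]_(t in `[a, b])
    (\1_(`[wake S i, sleep S i[%classic) t)%:E =
  (\sum_(i < nperiod S) overlap (wake S i) (sleep S i) a b)%:E)%E.
  rewrite -sumEFin; apply: eq_bigr => i _; rewrite integral_indic//.
  (* The step functions leave out the right end of the period, which [overlap] includes; a singleton
     is null. *)
  rewrite -measure_overlap -(@setUitv1 _ _ (BLeft (wake S i)) (sleep S i) true) ?bnd_simp//.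
  rewrite setIUl measureU0//; do ?exact: measurableI.
  apply/eqP; rewrite -measure_le0.
  rewrite -(lebesgue_measure_set1 (sleep S i)).
  by apply: le_measure => //; rewrite ?inE//; exact: measurableI.
by rewrite -EFinM.
Qed.

Definition window_start (R : realType) (M : model R) (S : trajectory R)
    (j : nat) : R := Num.max (arrival M j) (departure S j.-1).

Definition service (R : realType) (M : model R) (S : trajectory R)
    (m : 'I_(nperiod S)) (j : nat) : R :=
  overlap (wake S m) (sleep S m) (window_start M S j) (departure S j).

Lemma service_ge0 (R : realType) (M : model R) (S : trajectory R)
    (m : 'I_(nperiod S)) (j : nat) : 0 <= service M m j.
Proof. exact: overlap_ge0. Qed.

Lemma time_served_inE (R : realType) (M : model R) (S : trajectory R)
    (m : 'I_(nperiod S)) (j : nat) : time_served_in M m j = service M m j.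
Proof. by rewrite /time_served_in measure_overlap. Qed.

(** Dividing by the speed turns the work B into the service time [beta M], so that only sums of
    overlaps remain. *)
Lemma all_servedP (R : realType) (M : model R) (S : trajectory R) :
  0 < speed M -> (forall m, wake S m <= sleep S m) ->
  all_served M S <-> departure S 0 = 0 /\
    (forall j, is_task M j -> \sum_(m < nperiod S) service M m j = beta M).
Proof.
move=> speed0 uv; have sp0 : speed M != 0 by rewrite gt_eqF.
split=> -[x0 served]; split=> // j tj; have := served j tj.
  rewrite integral_rate ?ltW// /beta => <-.
  by rewrite mulrC mulKf.
by rewrite integral_rate ?ltW// => ->; rewrite /beta mulrC divfK.
Qed.

(** A degenerate window would meet every period in length 0. *)
Lemma window_lt (R : realType) (M : model R) (S : trajectory R) (j : nat) :
  0 < beta M -> \sum_(m < nperiod S) service M m j = beta M ->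
  (forall m, wake S m <= sleep S m) -> window_start M S j < departure S j.
Proof.
move=> b0 sumO uv; rewrite ltNge; apply/negP => xL.
suff O0 (m : 'I_(nperiod S)) : service M m j = 0 by move: b0; rewrite -sumO big1 ?ltxx.
apply/eqP; rewrite overlap_eq0 (le_trans _ (_ : window_start M S j <= _))//.
  by rewrite ge_min xL orbT.
by rewrite le_max lexx orbT.
Qed.

Lemma departure_nondecreasing (R : realType) (M : model R) (S : trajectory R)
    (i j : nat) :
  (forall j, is_task M j -> window_start M S j < departure S j) ->
  (i <= j)%N -> (j <= ntask M)%N -> departure S i <= departure S j.
Proof.
move=> Lx /subnKC <-; elim: (j - i)%N => [|r IH]; first by rewrite addn0.
rewrite addnS => le_N; apply: (le_trans (IH (ltnW le_N))).
by have := Lx (i + r).+1 le_N; rewrite gt_max => /andP[_ /ltW].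
Qed.

(** * Busy time and cost *)

(** Each window opens no earlier than the previous departure, so two windows share at most one
    instant and measures add up. *)
Lemma busy_timeE (R : realType) (M : model R) (S : trajectory R)
    (m : 'I_(nperiod S)) :
  (forall j, is_task M j -> window_start M S j < departure S j) ->
  busy_time M m = \sum_(1 <= j < (ntask M).+1) service M m j.
Proof.
move=> Lx; rewrite /busy_time.
have -> : [set j | is_task M j]%classic =
    [set j | (1 <= j < (ntask M).+1)%N]%classic by [].
suff H N : (N <= ntask M)%N ->
    lebesgue_measure (active_period m `&` \bigcup_(j in
      [set j | (1 <= j < N.+1)%N]) service_window M S j)%classic =
    (\sum_(1 <= j < N.+1) service M m j)%:E by rewrite H.
elim: N => [_|N IH leN].
  rewrite big_geq// (_ : [set j | _]%classic = set0) ?bigcup_set0 ?setI0 ?measure0//.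
  by apply/seteqP; split=> j //=; lia.
have -> : ([set j | (1 <= j < N.+2)%N] =
    [set j | (1 <= j < N.+1)%N] `|` [set N.+1])%classic.
  apply/seteqP; split=> j /=.
    move=> /andP[-> /=]; rewrite ltnS leq_eqVlt => /predU1P[->|]; by [right|left].
  by move=> [/andP[-> /= /ltnW]//|->]; rewrite ltnS leqnn.
rewrite bigcup_setU bigcup_set1 setIUr.
rewrite measureUfinl; last 3 first.
- apply: measurableI; first exact: measurable_itv.
  by apply: bigcup_measurable => j _; exact: measurable_itv.
- by apply: measurableI; exact: measurable_itv.
- by rewrite [X in (X < _)%E](IH (ltnW leN)) ltry.
rewrite [X in (X + _ - _)%E](IH (ltnW leN)).
rewrite [in RHS]big_nat_recr// EFinD.
rewrite [X in (_ + X - _)%E](measure_overlap _ _ _ _).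
(* [Z] is what window N+1 shares with the earlier ones; it lies in the singleton of
   [departure S N]. *)
set Z := (X in (_ - lebesgue_measure X)%E).
suff -> : lebesgue_measure Z = 0%E by rewrite sube0.
apply/eqP; rewrite -measure_le0 -(lebesgue_measure_set1 (departure S N)).
apply: le_measure.
- rewrite inE; apply: measurableI; apply: measurableI; try exact: measurable_itv.
  by apply: bigcup_measurable => j _; exact: measurable_itv.
- by rewrite inE.
move=> t [[_ [j /= /andP[j1 jN]]]]; rewrite /service_window/= in_itv/=.
move=> /andP[_ tx] [_]; rewrite in_itv/= ge_max => /andP[/andP[_ xt] _].
apply/eqP; rewrite eq_le xt andbT (le_trans tx)//.
by apply: (departure_nondecreasing (M := M)) => //; exact: ltnW.
Qed.

(** Summing the service over tasks instead of periods makes the busy time a constant, so two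
    trajectories compare by number of periods and total ON time alone. *)
Lemma cost_served (R : realType) (M : model R) (S : trajectory R) :
  0 < beta M -> (forall m, wake S m <= sleep S m) ->
  (forall j, is_task M j -> \sum_(m < nperiod S) service M m j = beta M) ->
  cost M S = (nperiod S)%:R * cost_wake M +
    cost_idle M * \sum_(m < nperiod S) (sleep S m - wake S m) +
    (cost_busy M - cost_idle M) * ((ntask M)%:R * beta M).
Proof.
move=> b0 uv sumO.
have Lx j : is_task M j -> window_start M S j < departure S j.
  by move=> tj; apply: window_lt => //; exact: sumO.
have -> : (ntask M)%:R * beta M = \sum_(m < nperiod S) busy_time M m.
  under eq_bigr do rewrite busy_timeE//.
  rewrite exchange_big/= (eq_big_nat _ _ (F2 := fun=> beta M)).
    by rewrite sumr_const_nat subn1 mulr_natl.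
  exact: sumO.
rewrite /cost -addrA; congr (_ + _); rewrite !mulr_sumr -big_split/=.
by apply: eq_bigr => m _; ring.
Qed.

(** * Consequences of the bounded arrival density *)

(** Otherwise the q+1 tasks l, ..., l+q would all arrive in the half-open window of length d that
    starts at the arrival of l. *)
Lemma arrival_spread (R : realType) (M : model R) (q l : nat) :
  (forall i j : nat, is_task M i -> is_task M j ->
    (i <= j)%N -> arrival M i <= arrival M j) ->
  bounded_density M -> Num.floor (delay M / beta M) = q%:Z ->
  is_task M l -> is_task M (l + q) ->
  arrival M l + delay M <= arrival M (l + q).
Proof.
move=> sorted dens fq tl tlq; rewrite leNgt; apply/negP => lt_d.
have /andP[l0 lN] := tl; have /andP[_ lqN] := tlq.
have ltN (r : 'I_q.+1) : (l.-1 + r < ntask M)%N by have := ltn_ord r; lia.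
(* The ordinal j stands for task j+1, so task l+r has index [l.-1 + r]. *)
pose f (r : 'I_q.+1) := Ordinal (ltN r).
have f_inj : injective f.
  by move=> r s /(congr1 val)/= /addnI rs; exact: val_inj.
have := dens (arrival M l); rewrite fq lez_nat leqNgt => /negP; apply.
rewrite -[q.+1]card_ord -cardsT -(card_imset _ f_inj).
apply: subset_leq_card; apply/fintype.subsetP => _ /imsetP[r _ ->]; rewrite inE /=.
have tr : is_task M (l.-1 + r).+1 by rewrite /is_task; have := ltn_ord r; lia.
rewrite sorted//=; last lia.
by apply: le_lt_trans lt_d; apply: sorted => //; have := ltn_ord r; lia.
Qed.

(* With q = floor (d / beta), tasks q positions apart arrive at least d apart
   and q beta <= d, so passing from task j - q to task j delays the deadline by
   at least as much as the completion. *)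
Lemma shifted_workload_le (R : realType) (M : model R) (w : R) (k j : nat) :
  (forall i j : nat, is_task M i -> is_task M j ->
    (i <= j)%N -> arrival M i <= arrival M j) ->
  0 < beta M -> bounded_density M -> 1 < Num.floor (delay M / beta M) ->
  (1 <= k)%N -> (k <= j)%N -> (j <= ntask M)%N ->
  (forall l, (k <= l <= j)%N ->
    w <= arrival M l \/ w + (l - k).+1%:R * beta M <= deadline M l) ->
  w + (j - k).+1%:R * beta M <= deadline M j.
Proof.
move=> sorted b0 dens floor1 k1.
have [q fq] : exists q : nat, Num.floor (delay M / beta M) = q%:Z.
  by exists `|Num.floor (delay M / beta M)|%N; rewrite gez0_abs// ltW// (lt_trans _ floor1).
have qb : q%:R * beta M <= delay M.
  by rewrite -ler_pdivlMr// -[q%:R]/(q%:Z%:~R) -fq floor_le_tmp.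
move: floor1; rewrite fq ltz_nat => q1.
elim/ltn_ind: j => j IH kj jN wl.
case: (wl j); rewrite ?kj ?leqnn// => wj.
(* With j-k < q, the j-k+1 services take at most q beta <= d, and they start at w <= a_j. Otherwise
   the induction hypothesis is used at j-q. *)
have [jkq|qjk] := ltnP (j - k) q.
  rewrite /deadline lerD// (le_trans _ qb)// ler_wpM2r ?ler_nat// ltW//.
have tj : is_task M (j - q) by rewrite /is_task; lia.
have spread := @arrival_spread R M q (j - q) sorted dens fq tj.
rewrite subnK in spread; last lia.
have {}spread : arrival M (j - q) + delay M <= arrival M j.
  by apply: spread; rewrite /is_task; lia.
have := IH (j - q)%N ltac:(lia) ltac:(lia) ltac:(lia).
rewrite /deadline => /(_ _) IHq.
have {}IHq : w + (j - q - k).+1%:R * beta M <= arrival M (j - q) + delay M.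
  by apply: IHq => l /andP[kl lj]; apply: wl; rewrite kl; lia.
have -> : (j - k).+1%:R = (j - q - k).+1%:R + q%:R :> R.
  by rewrite -natrD; congr _%:R; lia.
by rewrite mulrDl; lra.
Qed.

Lemma workload_le (R : realType) (M : model R) (l j : nat) :
  (forall i j : nat, is_task M i -> is_task M j ->
    (i <= j)%N -> arrival M i <= arrival M j) ->
  0 < beta M -> bounded_density M -> 1 < Num.floor (delay M / beta M) ->
  (1 <= l)%N -> (l <= j)%N -> (j <= ntask M)%N ->
  arrival M l + (j - l).+1%:R * beta M <= deadline M j.
Proof.
move=> sorted b0 dens floor1 l1 lj jN.
apply: shifted_workload_le => // i /andP[li ij]; left.
by apply: sorted; rewrite /is_task; lia.
Qed.

(** * The on-line wake-up time as the latest safe start *)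

(** As d_k - beta - delta_j = d_j - (j-k+1) beta, the scheduled time is the largest t satisfying
    these constraints; the default 0 of the maximum accounts for j = k. The converse half comes
    next. *)
Lemma scheduled_wakeup_ge (R : realType) (M : model R) (k q : nat) (t : R) :
  (forall j, (k <= j <= k + q)%N ->
    t + (j - k).+1%:R * beta M <= deadline M j) ->
  t <= scheduled_wakeup M k q.
Proof.
move=> tj; rewrite /scheduled_wakeup lerBrDl -lerBrDr.
rewrite big_nat_cond; apply: bigmax_le => [|j].
  by have := tj k; rewrite subnn leqnn leq_addr mul1r => /(_ isT); lra.
rewrite andbT => /andP[kj jq]; have := tj j ltac:(lia).
by rewrite /deadline_shift /deadline -natr1; lra.
Qed.

Lemma scheduled_wakeup_le (R : realType) (M : model R) (k q j : nat) :
  (k <= j <= k + q)%N ->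
  scheduled_wakeup M k q + (j - k).+1%:R * beta M <= deadline M j.
Proof.
move=> /andP[kj jq]; rewrite /scheduled_wakeup.
set mx := \big[_/_]_(_ <= _ < _) _.
have mx0 : 0 <= mx by exact: bigmax_ge_id.
move: kj; rewrite leq_eqVlt => /predU1P[<-|kj].
  by rewrite subnn mul1r; lra.
have : deadline_shift M k j <= mx.
  by apply: le_bigmax_seq => //; rewrite mem_index_iota; lia.
by rewrite /deadline_shift /deadline -natr1; lra.
Qed.

(** Tasks up to k+q enter the scheduled time; by the stopping rule, later ones arrive no earlier
    than the wake-up. These are the two alternatives of [shifted_workload_le]. *)
Lemma online_wakeup_le (R : realType) (M : model R) (k j : nat) :
  (forall i j : nat, is_task M i -> is_task M j ->
    (i <= j)%N -> arrival M i <= arrival M j) ->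
  0 < beta M -> bounded_density M -> 1 < Num.floor (delay M / beta M) ->
  (1 <= k)%N -> (k <= j)%N -> (j <= ntask M)%N ->
  online_wakeup M k + (j - k).+1%:R * beta M <= deadline M j.
Proof.
move=> sorted b0 dens floor1 k1 kj jN; rewrite /online_wakeup.
set p := (fun q => ~~ _); set q := find p _.
apply: shifted_workload_le => // l /andP[kl lj].
have [lq|ql] := leqP l (k + q); [right|left].
  by apply: scheduled_wakeup_le; rewrite kl.
have qN : (q < ntask M - k)%N by lia.
have : p q.
  have := @nth_find _ 0%N p (iota 0 (ntask M - k)).
  by rewrite has_find size_iota -/q qN nth_iota// => /(_ isT).
rewrite /p -leNgt => /le_trans; apply.
by apply: sorted; rewrite /is_task; lia.
Qed.

Lemma online_wakeup_ge (R : realType) (M : model R) (k : nat) (t : R) :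
  (1 <= k <= ntask M)%N ->
  (forall j, (k <= j <= ntask M)%N ->
    t + (j - k).+1%:R * beta M <= deadline M j) ->
  t <= online_wakeup M k.
Proof.
move=> kN tj; apply: scheduled_wakeup_ge => j jq; apply: tj.
set q := find _ _ in jq; have : (q <= ntask M - k)%N.
  by rewrite (leq_trans (find_size _ _)) ?size_iota.
by lia.
Qed.

(** * Upper bound on the start of a period *)

Lemma overlap_gt0_le (R : realType) (u v a b : R) : 0 < overlap u v a b ->
  Num.max u a + overlap u v a b <= Num.min v b.
Proof.
rewrite /overlap; move: (Num.max u a) (Num.min v b) => p q.
by case: (leP 0 (q - p)) => qp; lra.
Qed.

Lemma maxD_le_min (R : realType) (a b c p q : R) :
  Num.max a b + c <= Num.min p q ->
  [/\ a + c <= p, a + c <= q, b + c <= p & b + c <= q].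
Proof. by case: (leP a b) => ?; case: (leP p q) => ? ?; split; lra. Qed.

Lemma overlap_eq0_sep (R : realType) (u v a b : R) :
  overlap u v a b = 0 -> u < v -> a < b -> v <= a \/ b <= u.
Proof.
move=> /eqP; rewrite overlap_eq0 ge_min !le_max => /orP[]/orP[] h uv ab;
  by [left|right|lra].
Qed.

Lemma overlap_sep (R : realType) (u v a b : R) :
  v <= a \/ b <= u -> overlap u v a b = 0.
Proof.
by move=> h; apply/eqP; rewrite overlap_eq0 ge_min !le_max; case: h => ->;
  rewrite ?orbT.
Qed.

(** Peel off the last interval: it covers [a, b] only from [Num.max (u ord_max) a] on, and the
    others end before it starts, so cutting them at that point loses nothing. *)
Lemma sum_overlap_le (R : realType) (p : nat) (u v : 'I_p -> R) (a b : R) :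
  (forall m m' : 'I_p, (m < m')%N -> v m <= u m') -> a <= b ->
  \sum_(m < p) overlap (u m) (v m) a b <= b - a.
Proof.
elim: p u v b => [|p IH] u v b uv ab; first by rewrite big_ord0 subr_ge0.
rewrite big_ord_recr/=.
pose w (m : 'I_p) := widen_ord (leqnSn p) m.
have uvw (m m' : 'I_p) : (m < m')%N -> v (w m) <= u (w m') by move=> ?; exact: uv.
have := overlap_ge0 (u ord_max) (v ord_max) a b.
rewrite le_eqVlt => /predU1P[<-|o0].
  by rewrite addr0; exact: (IH (u \o w) (v \o w)).
have := overlap_gt0_le o0; rewrite le_min => /andP[_ ob].
have ab' : a <= Num.max (u ord_max) a by rewrite le_max lexx orbT.
have := IH (u \o w) (v \o w) _ uvw ab'.
suff : \sum_(m < p) overlap (u (w m)) (v (w m)) a b <=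
    \sum_(m < p) overlap (u (w m)) (v (w m)) a (Num.max (u ord_max) a) by lra.
apply: ler_sum => m _; rewrite ge_max overlap_ge0/= le_max; apply/orP; right.
rewrite lerD2r ge_min; apply/orP; left; rewrite le_min lexx/= le_max.
by rewrite uv//=.
Qed.

Lemma sumr_ge0_eq0 (R : realType) (p : nat) (F : 'I_p -> R) (i m : 'I_p) :
  (forall j, 0 <= F j) -> \sum_(j < p) F j = F i -> m != i -> F m = 0.
Proof.
move=> F0; rewrite (bigD1 i)//= => /(canRL (addKr _)); rewrite addNr => s0 mi.
by move/psumr_eq0P : s0; apply => // j _.
Qed.

Definition served (R : realType) (M : model R) (S : trajectory R) : Prop :=
  forall j, is_task M j -> \sum_(m < nperiod S) service M m j = beta M.

(** The ON time inside a window is at most the length of the window. *)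
Lemma departureS (R : realType) (M : model R) (S : trajectory R) (j : nat) :
  (forall m m' : 'I_(nperiod S), (m < m')%N -> sleep S m <= wake S m') ->
  (forall m, wake S m <= sleep S m) -> 0 < beta M -> served M S ->
  is_task M j -> window_start M S j + beta M <= departure S j.
Proof.
move=> vu uv b0 srv tj; rewrite -(srv j tj) -lerBrDl; apply: sum_overlap_le => //.
by apply/ltW/window_lt => //; exact: srv.
Qed.

Lemma form_period_window (R : realType) (M : model R) (S : trajectory R)
    (i : 'I_(nperiod S)) (k n : nat) : 0 < beta M -> form_period M i k n ->
  forall j, (k <= j <= n)%N ->
  Num.max (wake S i) (window_start M S j) + beta M <=
    Num.min (sleep S i) (departure S j).
Proof.
move=> b0 [k1 kn nN form] j kjn.
have tj : is_task M j by rewrite /is_task; lia.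
have := form j tj; rewrite kjn time_served_inE => sb.
by have := @overlap_gt0_le R (wake S i) (sleep S i) (window_start M S j)
  (departure S j); rewrite -/(service M i j) sb; apply.
Qed.

Lemma wake_le_online_wakeup (R : realType) (M : model R) (S : trajectory R)
    (i : 'I_(nperiod S)) (k n : nat) :
  0 < beta M -> ordered_periods S -> served M S ->
  (forall j, is_task M j -> departure S j <= deadline M j) ->
  form_period M i k n -> wake S i <= online_wakeup M k.
Proof.
move=> b0 [uv vu] srv dl form; have [k1 kn nN _] := form.
apply: online_wakeup_ge; first by lia.
move=> j /andP[kj jN]; apply: le_trans (dl j _); last by rewrite /is_task; lia.
rewrite -(subnKC kj) in jN *; move: (j - k)%N jN => r {kj}.
have -> : (k + r - k)%N = r by lia.
(* Task k is served wholly inside period i, which gives the base case; each further task adds one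
   service time, in whichever periods it is served. *)
elim: r => [|r IH] rN.
  have := form_period_window b0 form (j := k); rewrite leqnn kn => /(_ isT).
  by rewrite addn0 mul1r le_min => /andP[_]; apply: le_trans;
    rewrite lerD2r le_max lexx.
have := @departureS R M S (k + r.+1) _ (fun m => ltW (uv m)) b0 srv.
move=> /(_ (fun m m' mm' => ltW (vu m m' mm'))).
rewrite /is_task => /(_ ltac:(lia)); apply: le_trans.
rewrite -natr1 mulrDl mul1r addrA lerD2r (le_trans (IH _))//; first by lia.
by rewrite /window_start addnS le_max lexx orbT.
Qed.

(* The minimum is needed because a departure may formally be recorded after
   the period has ended, while the system is OFF. *)
Lemma form_period_workload (R : realType) (M : model R) (S : trajectory R)
    (i : 'I_(nperiod S)) (k n l j : nat) :
  0 < beta M -> form_period M i k n -> (k <= l)%N -> (l <= j)%N -> (j <= n)%N ->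
  Num.max (wake S i) (arrival M l) + (j - l).+1%:R * beta M <=
    Num.min (sleep S i) (departure S j).
Proof.
move=> b0 form kl lj; rewrite -(subnKC lj); move: (j - l)%N => r {lj}.
have -> : (l + r - l)%N = r by lia.
elim: r => [|r IH] rn.
  rewrite addn0 mul1r; apply: le_trans (form_period_window b0 form (j := l) _).
    by rewrite lerD2r ge_max /window_start !le_max !lexx ?orbT.
  by lia.
have := form_period_window b0 form (j := (l + r.+1)%N) ltac:(lia).
apply: le_trans; rewrite -natr1 mulrDl mul1r addrA lerD2r.
apply: (le_trans (IH ltac:(lia))).
by rewrite /window_start addnS ge_min !le_max lexx !orbT.
Qed.

(** * Restarting a period at a later time *)

(** Lindley's recursion for the departure of task k+r with constant service time. The base case
    omits the arrival of k because restarts take place at some t >= a_k. *)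
Fixpoint restart_departure (R : realType) (M : model R) (k : nat) (t : R)
    (r : nat) : R :=
  if r is r'.+1 then Num.max (arrival M (k + r)) (restart_departure M k t r') + beta M
  else t + beta M.

Lemma restart_departure_ge (R : realType) (M : model R) (k : nat) (t : R) (r : nat) :
  t + r.+1%:R * beta M <= restart_departure M k t r.
Proof.
elim: r => [|r IH]; first by rewrite mul1r.
by rewrite /= -natr1 mulrDl mul1r addrA lerD2r le_max IH orbT.
Qed.

Lemma restart_departure_nondecreasing (R : realType) (M : model R) (k : nat)
    (t : R) (r s : nat) : 0 <= beta M -> (r <= s)%N ->
  restart_departure M k t r <= restart_departure M k t s.
Proof.
move=> b0 /subnKC <-; elim: (s - r)%N => [|e IH]; first by rewrite addn0.
rewrite addnS/= (le_trans IH)// -[leLHS]addr0 lerD// le_max lexx orbT//.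
Qed.

(** Unrolled, the recursion is a maximum over runs of back-to-back services begun at t or at the
    arrival of some l; each of these is bounded by c. *)
Lemma restart_departure_le (R : realType) (M : model R) (k : nat) (t c : R) (r : nat) :
  t + r.+1%:R * beta M <= c ->
  (forall l, (k < l <= k + r)%N -> arrival M l + (k + r - l).+1%:R * beta M <= c) ->
  restart_departure M k t r <= c.
Proof.
elim: r c => [|r IH] c tc ac; first by rewrite mul1r in tc.
rewrite /= -lerBrDr ge_max; apply/andP; split.
  by have := ac (k + r.+1)%N; rewrite subnn mul1r lerBrDr; apply; lia.
apply: IH => [|l kl]; rewrite lerBrDr.
  by move: tc; rewrite -[r.+2%:R]natr1 mulrDl mul1r addrA.
have := ac l; rewrite addnS subSn; last by lia.
by rewrite -natr1 mulrDl mul1r addrA; apply; lia.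
Qed.

Definition restart (R : realType) (M : model R) (S : trajectory R)
    (i : 'I_(nperiod S)) (k n : nat) (t : R) : trajectory R :=
  Trajectory (fun m => if m == i then t else wake S m)
    (fun m => if m == i then restart_departure M k t (n - k) else sleep S m)
    (fun j => if (k <= j <= n)%N then restart_departure M k t (j - k)
              else departure S j).

(** Tasks k, ..., n stay inside period i. Among the other tasks only n+1 gets a different window,
    and that change falls outside the periods that serve it. *)
Lemma restart_service (R : realType) (M : model R) (S : trajectory R)
    (i : 'I_(nperiod S)) (k n : nat) (t : R) (m : 'I_(nperiod S)) (j : nat) :
  (forall j : nat, is_task M j -> 0 <= arrival M j) ->
  0 < beta M -> ordered_periods S -> served M S -> departure S 0 = 0 ->
  form_period M i k n -> wake S i <= t -> arrival M k <= t ->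
  (forall m' : 'I_(nperiod S), (i < m')%N ->
    restart_departure M k t (n - k) <= wake S m') ->
  is_task M j -> service M (m : 'I_(nperiod (restart M i k n t))) j = service M m j.
Proof.
move=> a0 b0 [uv vu] srv x0 form ut akt yu tj.
have [k1 kn nN form_i] := form.
set y := restart_departure M k t in yu *.
have Lx l : is_task M l -> window_start M S l < departure S l.
  by move=> tl; apply: window_lt => //; [exact: srv|move=> ?; exact: ltW].
have in_i l : is_task M l -> service M i l = if (k <= l <= n)%N then beta M else 0.
  by move=> tl; rewrite -time_served_inE form_i.
(* Period i already provides all of the service time [beta M], so every other period misses the
   window. *)
have off_i l (p : 'I_(nperiod S)) : (k <= l <= n)%N -> p != i ->
    sleep S p <= window_start M S l \/ departure S l <= wake S p.
  move=> kln pi; have tl : is_task M l by rewrite /is_task; lia.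
  apply: overlap_eq0_sep; rewrite ?Lx//.
  apply: (sumr_ge0_eq0 (F := fun q => service M q l) (i := i)) => //.
    by move=> q; exact: service_ge0.
  by rewrite srv// in_i// kln.
have first l : (k <= l <= n)%N ->
    wake S i < departure S l /\ window_start M S l < sleep S i.
  move=> kln; have [_ ux Lv _] := maxD_le_min (form_period_window b0 form kln).
  by split; lra.
have before (p : 'I_(nperiod S)) : (p < i)%N -> sleep S p <= window_start M S k.
  move=> pi; have kk : (k <= k <= n)%N by rewrite leqnn.
  have [//|xu] := off_i k p kk (ltac:(by rewrite neq_ltn pi)).
  by have := first k kk; have := vu p i pi; have := uv p; lra.
have after (p : 'I_(nperiod S)) : (i < p)%N -> departure S n <= wake S p.
  move=> ip; have nn : (k <= n <= n)%N by rewrite leqnn kn.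
  have [vL|//] := off_i n p nn (ltac:(by rewrite neq_ltn ip orbT)).
  by have := first n nn; have := vu i p ip; have := uv p; lra.
have xk1 : departure S k.-1 <= t.
  (* For k = 1 the predecessor is the fictitious task 0, which departs at 0. *)
  have [k_1|k_gt1] := leqP k 1.
    have -> : k.-1 = 0%N by lia.
    by rewrite x0 (le_trans _ akt)// a0// /is_task; lia.
  have tk1 : is_task M k.-1 by rewrite /is_task; lia.
  have out : (k <= k.-1 <= n)%N = false by lia.
  have [|vL|xu] := overlap_eq0_sep _ (uv i) (Lx k.-1 tk1).
  - by have := in_i _ tk1; rewrite out.
  - have [_] := first k (ltac:(by rewrite leqnn)).
    rewrite gt_max => /andP[_ xv].
    by have := Lx _ tk1; lra.
  - exact: le_trans ut.
have tyn : t < y (n - k)%N.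
  have := @restart_departure_ge _ M k t (n - k); rewrite -/y.
  by apply: lt_le_trans; rewrite ltrDl mulr_gt0.
have wsE l : (l < k)%N || (n.+1 < l)%N -> window_start M (restart M i k n t) l =
    window_start M S l.
  by move=> out; rewrite /window_start/=; case: ifP => //; lia.
have dE l : (l < k)%N || (n < l)%N -> departure (restart M i k n t) l = departure S l.
  by move=> out /=; case: ifP => //; lia.
have [jk|kj] := ltnP j k.
  rewrite /service wsE ?jk// dE ?jk//=; case: eqVneq => // ->.
  rewrite -/(service M i j) in_i// [in RHS]leqNgt jk/=.
  apply: overlap_sep; right; apply: le_trans xk1.
  by apply: (departure_nondecreasing (M := M)) => //; lia.
have [jn|nj] := leqP j n.
  have kjn : (k <= j <= n)%N by rewrite kj.
  have rhs : service M m j = if m == i then beta M else 0.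
    case: eqVneq => [->|mi]; first by rewrite in_i// kjn.
    exact/overlap_sep/off_i.
  have dj : departure (restart M i k n t) j = y (j - k)%N by rewrite /= kjn.
  have yn : y (j - k)%N <= y (n - k)%N.
    by apply: restart_departure_nondecreasing; [exact: ltW|lia].
  (* Only the window of task k may open before t; for later tasks the previous new departure already
     exceeds t. *)
  have [yE bL] : y (j - k)%N = Num.max t (window_start M (restart M i k n t) j) + beta M
      /\ forall p : 'I_(nperiod S), (p < i)%N ->
        sleep S p <= window_start M (restart M i k n t) j.
    move: kj; rewrite leq_eqVlt => /predU1P[kj|kj].
      have -> : window_start M (restart M i k n t) j = window_start M S k.
        by rewrite /window_start/= -kj; case: ifP => //; lia.
      split=> //; rewrite -kj subnn max_l//.
      by rewrite /window_start ge_max akt.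
    have Lj : window_start M (restart M i k n t) j =
        Num.max (arrival M j) (y (j.-1 - k)%N).
      by rewrite /window_start/=; case: ifP => //; lia.
    have ty : t <= y (j.-1 - k)%N.
      by have := @restart_departure_ge _ M k t (j.-1 - k); apply: le_trans;
        rewrite lerDl mulr_ge0// ltW.
    have tL : t <= window_start M (restart M i k n t) j by rewrite Lj le_max ty orbT.
    split=> [|p pi]; last by have := vu p i pi; lra.
    rewrite max_r// Lj.
    have -> : (j - k = (j.-1 - k).+1)%N by lia.
    by rewrite /y/=; congr (Num.max (arrival M _) _ + _); lia.
  rewrite rhs /service dj/=; case: eqVneq => [mi|mi].
    by rewrite /overlap min_r// yE addrAC subrr add0r max_r// ltW.
  apply: overlap_sep; move: mi; rewrite neq_ltn => /orP[mi|im]; first by left; exact: bL.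
  by right; apply: (le_trans yn); exact: yu.
have tn1 : is_task M n.+1 by move: tj; rewrite /is_task; lia.
have xL : departure S n <= window_start M S n.+1 by rewrite le_max lexx orbT.
have uxn : wake S i < departure S n by have [] := first n (ltac:(by rewrite kn leqnn)).
(* Task n+1 must be served in some period after i, hence departs after the new departure of n. *)
have [p ip xp] : exists2 p : 'I_(nperiod S), (i < p)%N & wake S p < departure S n.+1.
  apply: contrapT => none; move: b0; rewrite -(srv _ tn1) big1 ?ltxx// => p _.
  have [pi|ip|/val_inj ->] := ltngtP p i; last by rewrite in_i// ltnn andbF.
    by apply: overlap_sep; left; have := vu p i pi; lra.
  by apply: overlap_sep; right; rewrite leNgt; apply/negP => xp; apply: none; exists p.
have yx : y (n - k)%N < departure S n.+1 by apply: le_lt_trans xp; exact: yu.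
have dj : departure (restart M i k n t) j = departure S j by rewrite dE// nj orbT.
have [jn1|jn1] := leqP j n.+1; last first.
  rewrite /service wsE ?jn1 ?orbT// dj/=; case: eqVneq => // ->.
  rewrite -/(service M i j) in_i//; case: ifP => [|_]; first by move=> /andP[_]; rewrite leqNgt nj.
  apply: overlap_sep; left; rewrite (le_trans (ltW yx))// le_max.
  apply/orP; right; apply: (departure_nondecreasing (M := M)) => //; first by lia.
  by move/andP: tj => []; lia.
have jE : j = n.+1 by apply/eqP; rewrite eqn_leq jn1 nj.
rewrite {j kj nj jn1}jE in tj dj *.
have L' : window_start M (restart M i k n t) n.+1 = Num.max (arrival M n.+1) (y (n - k)%N).
  by rewrite /window_start/= kn leqnn.
have yL : y (n - k)%N <= window_start M (restart M i k n t) n.+1.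
  by rewrite L' le_max lexx orbT.
have [mi|im|/val_inj mi] := ltngtP m i.
- rewrite /service/= (negbTE (_ : m != i)) ?neq_ltn ?mi//.
  by rewrite !overlap_sep//; left; have := vu m i mi; lra.
- rewrite /service dj/= (negbTE (_ : m != i)) ?neq_ltn ?im ?orbT// L' /overlap.
  (* Both the old and the new departure of n precede the wake-up of m, which absorbs them in the
     maximum. *)
  rewrite /window_start; congr (Num.max 0 (_ - _)).
  by rewrite [LHS]maxCA [RHS]maxCA (max_l (yu _ im)) (max_l (after _ im)).
- rewrite mi in_i// ltnn andbF; apply: overlap_sep; left.
  by rewrite /= eqxx.
Qed.

(** * Merging two adjacent periods *)

(** Delete the common instant from the wake-ups (at j) and from the sleeps (at i). Its terms cancel
    in any sum of f(wake) - f(sleep): step functions for f give the rate, the identity gives the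
    total length. *)
Lemma merge_periods (R : realType) (M : model R) (S : trajectory R)
    (i j : 'I_(nperiod S)) :
  j = i.+1 :> nat -> sleep S i = wake S j ->
  (forall m, wake S m < sleep S m) ->
  (forall m m' : 'I_(nperiod S), (m < m')%N -> (m != i) || (m' != j) ->
    sleep S m < wake S m') ->
  exists S' : trajectory R, [/\ ordered_periods S', (nperiod S').+1 = nperiod S,
    departure S' = departure S, rate M S' =1 rate M S &
    \sum_(m < nperiod S') (sleep S' m - wake S' m) =
    \sum_(m < nperiod S) (sleep S m - wake S m)].
Proof.
case: S i j => [[|p] u v x] i j /=; first by case: i.
move=> ji vi_uj uv vu.
have sumB (f : R -> R) :
    \sum_(m < p) (f (u (lift j m)) - f (v (lift i m))) =
    \sum_(m < p.+1) (f (u m) - f (v m)).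
  by rewrite !sumrB (bigD1_ord j)// (bigD1_ord i)//= vi_uj; ring.
exists (@Trajectory R p (fun m => u (lift j m)) (fun m => v (lift i m)) x).
split=> //=; last 2 first.
- by move=> t; rewrite /rate/= (sumB (fun s => unit_step (t - s))).
- apply: oppr_inj; rewrite -!sumrN.
  under eq_bigr do rewrite opprB; under [RHS]eq_bigr do rewrite opprB.
  exact: (sumB id).
have weak (a b : 'I_p.+1) : (a < b)%N -> v a <= u b.
  move=> ab; have [/vu|] := boolP ((a != i) || (b != j)); first by move/(_ ab)/ltW.
  by rewrite negb_or !negbK => /andP[/eqP -> /eqP ->]; rewrite vi_uj.
split=> /= [m|m m' mm']; last first.
  apply: vu; last by rewrite eq_sym neq_lift.
  by rewrite /= /bump ji; lia.
(* The two indices differ only at m = i, where the merged period runs from the wake-up of i to the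
   sleep of j. *)
have : (lift j m <= lift i m)%N by rewrite /= /bump ji; lia.
rewrite leq_eqVlt => /predU1P[/val_inj ->//|/weak vu'].
by have := uv (lift j m); have := uv (lift i m); lra.
Qed.

Lemma rate_served (R : realType) (M : model R) (S S' : trajectory R) :
  departure S' = departure S -> rate M S' =1 rate M S ->
  all_served M S -> all_served M S'.
Proof.
move=> dE rE; rewrite /all_served /service_window dE => -[x0 srv]; split=> // j tj.
by rewrite -(srv j tj); apply: eq_Rintegral => t _.
Qed.

(** A run begun at the arrival of some l > k already fitted in the old period, so it ends by
    [sleep S i]; only the run from t may end later. *)
Lemma restart_departure_sleep (R : realType) (M : model R) (S : trajectory R)
    (i : 'I_(nperiod S)) (k n : nat) (t c : R) :
  0 < beta M -> form_period M i k n ->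
  t + (n - k).+1%:R * beta M <= c -> sleep S i <= c ->
  restart_departure M k t (n - k) <= c.
Proof.
move=> b0 form tc vc; have [_ kn _ _] := form.
apply: restart_departure_le => // l; rewrite subnKC// => /andP[kl ln].
have [_ _ av _] := maxD_le_min (form_period_workload b0 form (ltnW kl) ln (leqnn n)).
exact: le_trans vc.
Qed.

(** * Optimality of the on-line start *)

(** Runs from t meet the deadlines because t is at most the on-line time, runs from an arrival by
    density. Strict ordering of the periods is not claimed: the new period may end exactly at the
    next wake-up, as the merging argument requires. *)
Lemma restart_improves (R : realType) (M : model R) (S : trajectory R)
    (i : 'I_(nperiod S)) (k n : nat) (t : R) :
  (forall j : nat, is_task M j -> 0 <= arrival M j) ->
  (forall i j : nat, is_task M i -> is_task M j ->
    (i <= j)%N -> arrival M i <= arrival M j) ->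
  0 < speed M -> 0 < beta M -> 0 <= cost_idle M ->
  bounded_density M -> 1 < Num.floor (delay M / beta M) ->
  feasible M S -> form_period M i k n ->
  wake S i <= t -> arrival M k <= t -> t <= online_wakeup M k ->
  (forall m : 'I_(nperiod S), (i < m)%N ->
    restart_departure M k t (n - k) <= wake S m) ->
  [/\ forall m, wake (restart M i k n t) m < sleep (restart M i k n t) m,
      all_served M (restart M i k n t),
      forall j, is_task M j -> departure (restart M i k n t) j <= deadline M j &
      cost M (restart M i k n t) <= cost M S].
Proof.
move=> a0 sorted sp0 b0 ci0 dens floor1 [ord sserv dl] form ut akt tw yu.
have [uv vu] := ord; have [k1 kn nN _] := form.
have uv' m : wake S m <= sleep S m by exact: ltW.
have [x0 srv] := (all_servedP sp0 uv').1 sserv.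
have ty : t < restart_departure M k t (n - k).
  by apply: lt_le_trans (restart_departure_ge _ _ _ _); rewrite ltrDl mulr_gt0.
have ruv (m : 'I_(nperiod S)) :
    wake (restart M i k n t) m < sleep (restart M i k n t) m.
  by rewrite /=; case: eqVneq.
have rsrv : served M (restart M i k n t).
  move=> j tj; rewrite -(srv j tj); apply: eq_bigr => m _.
  exact: restart_service.
split=> //.
- apply/all_servedP => //; first by move=> m; exact: ltW.
  by split=> //=; case: ifP => //; lia.
- move=> j tj /=; case: ifP => [kjn|_]; last exact: dl.
  have /andP[_ jN] := tj; apply: restart_departure_le => [|l].
    apply: le_trans (@online_wakeup_le _ M k j _ _ _ _ _ _ _) => //; last by lia.
    by rewrite lerD2r.
  rewrite subnKC; last by lia.
  by move=> klj; apply: workload_le => //; lia.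
- rewrite !cost_served//; last by move=> m; exact: ltW.
  rewrite lerD2r lerD2l ler_wpM2l//= (bigD1 i)//= eqxx [leRHS](bigD1 i)//=.
  apply: lerD; last by apply: ler_sum => m /negbTE ->.
  have [uc _ _ _] := maxD_le_min (form_period_workload b0 form (leqnn k) kn (leqnn n)).
  (* The end is delayed by no more than the start, because the old period has length at least
     (n-k+1) beta. *)
  have : restart_departure M k t (n - k) <= sleep S i + (t - wake S i).
    by apply: (restart_departure_sleep b0 form); lra.
  by lra.
Qed.

Lemma online_restart_optimal (R : realType) (M : model R) (S : trajectory R)
    (i : 'I_(nperiod S)) (k n : nat) :
  (forall j : nat, is_task M j -> 0 <= arrival M j) ->
  (forall i j : nat, is_task M i -> is_task M j ->
    (i <= j)%N -> arrival M i <= arrival M j) ->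
  0 < speed M -> 0 < beta M -> 0 < cost_wake M -> 0 <= cost_idle M ->
  bounded_density M -> 1 < Num.floor (delay M / beta M) ->
  optimal M S -> form_period M i k n ->
  exists (S' : trajectory R) (i' : 'I_(nperiod S')),
    [/\ optimal M S', form_period M i' k n & wake S' i' = online_wakeup M k].
Proof.
move=> a0 sorted sp0 b0 cw0 ci0 dens floor1 [feas opt] form.
have [ord sserv dl] := feas; have [uv vu] := ord; have [k1 kn nN form_i] := form.
have uv' m : wake S m <= sleep S m by exact: ltW.
have [x0 srv] := (all_servedP sp0 uv').1 sserv.
have uw : wake S i <= online_wakeup M k by exact: wake_le_online_wakeup form.
have aw : arrival M k <= online_wakeup M k.
  apply: online_wakeup_ge => [|j /andP[kj jN]]; first by lia.
  exact: workload_le.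
set w := online_wakeup M k in uw aw *.
have [clear|] := pselect (forall m : 'I_(nperiod S), (i < m)%N ->
    restart_departure M k w (n - k) < wake S m).
  have yu (m : 'I_(nperiod S)) : (i < m)%N ->
      restart_departure M k w (n - k) <= wake S m by move=> /clear/ltW.
  have [ruv rserv rdl rcost] := restart_improves a0 sorted sp0 b0 ci0 dens floor1
    feas form uw aw (lexx w) yu.
  exists (restart M i k n w), i; split; last by rewrite /= eqxx.
  - split=> [|S' feas']; last exact: le_trans (opt _ feas').
    split=> //; split=> // m m' /= mm'; case: (eqVneq m i) => [mi|mi]; subst.
      have /negbTE -> : m' != i by rewrite neq_ltn mm' orbT.
      exact: clear.
    case: eqVneq => [mi'|_]; last exact: vu.
    by apply: lt_le_trans uw; apply: vu; rewrite -mi'.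
  - split=> // j tj; rewrite -form_i// !time_served_inE.
    exact: restart_service.
move/existsNP => [m0 /not_implyP[im0 /negP]]; rewrite -leNgt => y_m0.
have iN : (i.+1 < nperiod S)%N by apply: leq_ltn_trans (ltn_ord m0).
pose i1 := Ordinal iN.
have [c cE] : {c | c = (n - k).+1%:R * beta M} by exists ((n - k).+1%:R * beta M).
have ui1 (m : 'I_(nperiod S)) : (i < m)%N -> wake S i1 <= wake S m.
  rewrite leq_eqVlt => /predU1P[im|im].
    by rewrite (_ : m = i1)//; exact: val_inj.
  by apply/ltW/(lt_trans (uv i1)); exact: vu.
have vi1 : sleep S i < wake S i1 by exact: vu.
(* The new end is at most the larger of w + c and [sleep S i], and the latter precedes [wake S i1];
   so w + c causes the obstruction. *)
have i1w : wake S i1 <= w + c.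
  rewrite leNgt; apply/negP => lt1.
  pose b := Num.max (w + c) (sleep S i).
  have : restart_departure M k w (n - k) <= b.
    by apply: (restart_departure_sleep b0 form); rewrite -?cE le_max lexx ?orbT.
  have : b < wake S i1 by rewrite gt_max lt1.
  by have := ui1 m0 im0; lra.
have [uc _ ac _] := maxD_le_min (form_period_workload b0 form (leqnn k) kn (leqnn n)).
(* With this [t] the services run back to back up to [wake S i1]. The old period contains c units of
   work done after a_k and ends before [wake S i1], so t exceeds both a_k and [wake S i]. *)
rewrite -cE in uc ac; have [t tE] : {t | t = wake S i1 - c} by exists (wake S i1 - c).
have yt : restart_departure M k t (n - k) = wake S i1.
  apply/eqP; rewrite eq_le; apply/andP; split.
    by apply: (restart_departure_sleep b0 form); rewrite -?cE; lra.
  by have := @restart_departure_ge _ M k t (n - k); rewrite -cE; lra.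
have [||||ruv rserv rdl rcost] := @restart_improves _ M S i k n t a0 sorted sp0 b0
  ci0 dens floor1 feas form.
- by lra.
- by lra.
- by rewrite -/w; lra.
- by move=> m im; rewrite yt; exact: ui1.
have [|||S' [ord' nS' dS' rS' sumS']] :=
    @merge_periods _ M (restart M i k n t) i i1 _ _ ruv.
- by [].
- by rewrite /= eqxx yt (negbTE (_ : i1 != i))// neq_ltn ltnSn orbT.
- move=> m m' mm' /=; case: (eqVneq m i) => [mi|mi] /=; subst.
    move=> m'i1; have /negbTE -> : m' != i by rewrite neq_ltn mm' orbT.
    rewrite yt (lt_trans (uv i1))// vu//= ltn_neqAle mm' andbT eq_sym.
    by apply: contra m'i1 => /eqP m'i1; apply/eqP/val_inj.
  move=> _; case: eqVneq => [mi'|_]; last exact: vu.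
  have vm : sleep S m < wake S i by apply: vu; rewrite -mi'.
  by lra.
have serv' := rate_served dS' rS' rserv.
have feas' : feasible M S' by split=> // j tj; rewrite dS'; exact: rdl.
have [uv2 _] := ord'.
have [_ srv'] := (all_servedP sp0 (fun m => ltW (uv2 m))).1 serv'.
have [_ rsrv] := (all_servedP sp0 (fun m => ltW (ruv m))).1 rserv.
have := opt _ feas'; move: rcost.
rewrite (cost_served b0 (fun m => ltW (ruv m)) rsrv).
rewrite (cost_served b0 (fun m => ltW (uv2 m)) srv') sumS'.
have -> : (nperiod (restart M i k n t))%:R = (nperiod S')%:R + 1 :> R.
  by rewrite natr1 nS'.
by rewrite mulrDl mul1r; lra.
Qed.

Theorem lemma6 (R : realType) (M : model R)
  (arrival_ge0 : forall j : nat, is_task M j -> 0 <= arrival M j)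
  (arrival_sorted : forall i j : nat, is_task M i -> is_task M j ->
     (i <= j)%N -> arrival M i <= arrival M j)
  (delay_gt0 : 0 < delay M) (ops_gt0 : 0 < ops M) (speed_gt0 : 0 < speed M)
  (cost_wake_gt0 : 0 < cost_wake M) (cost_idle_ge0 : 0 <= cost_idle M)
  (cost_idle_le_busy : cost_idle M <= cost_busy M)
  (density : bounded_density M)
  (floor_gt1 : 1 < Num.floor (delay M / beta M))
  (S : trajectory R) (i : 'I_(nperiod S)) (k n : nat)
  (S_optimal : optimal M S) (S_period : form_period M i k n)
  (P : trajectory R) (P_online : online_trajectory M P)
  (P_off : off_before M P k)
  (w : R) (P_wakeup : first_wakeup_from P (arrival M k) w) :
  w = online_wakeup M k /\ optimal_start M k n w.
Proof.
have [k1 kn nN _] := S_period.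
have tk : is_task M k by rewrite /is_task k1 (leq_trans kn nN).
have b0 : 0 < beta M by rewrite divr_gt0.
have [_ _ /(_ k tk P_off) [a_on [i_on on_i] on_first]] := P_online.
have [a_w [i_w w_i] w_first] := P_wakeup.
(* Both are the first wake-up of [P] from the arrival of k on. *)
have -> : w = online_wakeup M k.
  by apply/eqP; rewrite eq_le -{1}on_i -{2}w_i w_first ?on_first ?on_i ?w_i.
split=> //; split; first exact: (online_restart_optimal _ _ _ _ _ _ _ _ S_optimal S_period).
move=> S' i' [[ord srv dl] _] form.
apply: wake_le_online_wakeup form => //.
by case: ord => uv _; have [_] := (all_servedP speed_gt0 (fun m => ltW (uv m))).1 srv.
Qed.
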